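(* Let $\nu>0$, $\Delta t>0$, and let $f^{\{k\}}$ be given. Let $f^{\{k+1\}}$ satisfy the backward Euler equation $$f^{\{k+1\}}+\Delta t\,vAf^{\{k+1\}}+\nu\Delta t f^{\{k+1\}}=f^{\{k\}}+\nu\Delta t\,\mathsf{M}\,n_{f^{\{k+1\}}},$$ and let $\{f^\ell\}_\ell$ be generated by the source iteration $$f^{\ell+1}+\Delta t\,vAf^{\ell+1}+\nu\Delta t f^{\ell+1}=f^{\{k\}}+\nu\Delta t\,\mathsf{M}\,n_{f^\ell}.$$ Define $e^\ell=f^\ell-f^{\{k+1\}}$. Then $$(1+\nu\Delta t)\|P_{\mathsf M}e^{\ell+1}\|_{\mathsf M}^2+(1+\nu\Delta t)\|P_{\mathsf M}^\perp e^{\ell+1}\|_{\mathsf M}^2\le\nu\Delta t\,\|P_{\mathsf M}e^\ell\|_{\mathsf M}\,\|P_{\mathsf M}e^{\ell+1}\|_{\mathsf M}.$$ Moreover, $$\|P_{\mathsf M}e^{\ell+1}\|_{\mathsf M}\le\frac{\nu\Delta t}{1+\nu\Delta t}\,\|P_{\mathsf M}e^\ell\|_{\mathsf M}.$$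
   Context: Setting: the linear BGK model $\partial_tf+v\partial_xf=\nu(n_f\mathsf{M}-f)$ with periodic boundary conditions in $x\in\Omega_x$ (a bounded interval), discretized in $x$ only (velocity $v\in\mathbb{R}$ is left continuous). Here $\langle\cdot\rangle_v=\int_{\mathbb{R}}(\cdot)\,dv$, $n_f=\langle f\rangle_v$, and, for constants $u_0\in\mathbb{R}$, $\theta_0>0$, $$\mathsf{M}(v)=\frac{1}{\sqrt{2\pi\theta_0}}\exp\left(-\frac{(v-u_0)^2}{2\theta_0}\right).$$ $V_{x,h}\subset L^2(\Omega_x)$ is a finite-dimensional (discontinuous piecewise polynomial) space with mesh parameter $h_x>0$. $\partial_x$ is discretized by central differences with periodic boundary conditions, giving a linear operator $A:V_{x,h}\to V_{x,h}$ that is skew-symmetric with respect to the $L^2(\Omega_x)$ inner product; its eigenvalues are of the form $i\lambda$ with $\lambda\in\mathbb{R}$, $|\lambda|\le 1/h_x$. $A$ acts on functions of $(x,v)$ in the $x$ variable for each fixed $v$. The inner product is $(w,z)_{\mathsf M}=\int_{\Omega_x\times\mathbb{R}}w\,z\,\mathsf{M}^{-1}\,dx\,dv$ with norm $\|\cdot\|_{\mathsf M}$. All functions $f^{\{k\}},f^{\{k+1\}},f^\ell$ are functions of $(x,v)$ lying in $V_{x,h}$ as functions of $x$ and with finite $\|\cdot\|_{\mathsf M}$ norm. $P_{\mathsf M}w=\langle w\rangle_v\mathsf{M}=\mathsf{M}n_w$, which is an orthogonal projection for $(\cdot,\cdot)_{\mathsf M}$, and $P_{\mathsf M}^\perp=I-P_{\mathsf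 M}$. *)

(* Defs.v *)
From HB Require Import structures.
From mathcomp Require Import all_boot all_order all_algebra.
From mathcomp Require Import all_classical all_reals all_analysis.
From mathcomp Require Import complex.
Set Implicit Arguments.
Unset Strict Implicit.
Unset Printing Implicit Defensive.
Import Order.TTheory GRing.Theory Num.Theory.
Import numFieldNormedType.Exports.
Local Open Scope classical_set_scope.
Local Open Scope ring_scope.

(* Elements of the L^2 spaces below are represented by functions, and equality
   in L^2 is almost-everywhere equality on the domain. *)

Section PhysicalSpace.
Context {R : realType}.
Local Notation mu := (@lebesgue_measure R).

Definition Omega (a b : R) : set R := `[a, b].

Definition L2Omega (a b : R) (u : R -> R) : Prop :=
  measurable_fun (Omega a b) u /\
  mu.-integrable (Omega a b) (fun x => (u x ^+ 2)%:E).

(* The i-th cell of the mesh a < s_0 < ... < s_(N-1) = b. *)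
Definition cell (a : R) (s : seq R) (i : nat) : set R :=
  `]nth 0 (a :: s) i, nth 0 (a :: s) i.+1[.

(* V is a finite-dimensional subspace of L^2(a, b) made of piecewise
   polynomials on the mesh s; no continuity is imposed across cells. *)
Record dg_space (a b : R) (s : seq R) (V : set (R -> R)) : Prop := DGSpace {
  dg_zero : V (fun=> 0);
  dg_add : forall u w, V u -> V w -> V (fun x => u x + w x);
  dg_scale : forall (c : R) u, V u -> V (fun x => c * u x);
  dg_L2 : forall u, V u -> L2Omega a b u;
  dg_finite_dim : exists (n : nat) (phi : 'I_n -> R -> R),
    (forall i, V (phi i)) /\
    (forall u, V u -> exists c : 'I_n -> R,
       u = (fun x => \sum_(i < n) c i * phi i x) %[ae mu in Omega a b]);
  dg_piecewise_poly : forall u, V u -> forall i, (i < size s)%N ->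
    exists p : {poly R}, u = (fun x => p.[x]) %[ae mu in cell a s i]
}.

(* z is an eigenvalue of the complexification of A : V -> V. *)
Definition is_eigenvalue (a b : R) (V : set (R -> R))
    (A : (R -> R) -> (R -> R)) (z : R[i]) : Prop :=
  exists u : R -> R[i],
    let re := fun x => complex.Re (u x) in
    let im := fun x => complex.Im (u x) in
    [/\ V re, V im,
        ~ (u = (fun=> 0) %[ae mu in Omega a b]) &
        (fun x => Complex (A re x) (A im x)) = (fun x => z * u x)
          %[ae mu in Omega a b] ].

(* The properties of the periodic central-difference operator A : V -> V,
   with mesh parameter h. *)
Record central_difference (a b h : R) (V : set (R -> R))
    (A : (R -> R) -> (R -> R)) : Prop := CentralDifference {
  cd_stable : forall u, V u -> V (A u);
  cd_linear : forall (c : R) u w, V u -> V w ->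
    A (fun x => c * u x + w x) = (fun x => c * A u x + A w x)
      %[ae mu in Omega a b];
  cd_skew : forall u w, V u -> V w ->
    \int[mu]_(x in Omega a b) (A u x * w x) =
    - \int[mu]_(x in Omega a b) (u x * A w x);
  cd_spectrum : forall z : R[i], is_eigenvalue a b V A z ->
    exists lambda : R, z = Complex 0 lambda /\ `|lambda| <= h^-1
}.

End PhysicalSpace.

Section PhaseSpace.
Context {R : realType}.
Local Notation mu := (@lebesgue_measure R).

(* Points of phase space are pairs (x, v). *)
Definition mu2 := (@lebesgue_measure R \x @lebesgue_measure R)%E.

Definition phase (a b : R) : set (R * R) := Omega a b `*` setT.

Definition maxwellian (u0 theta0 v : R) : R :=
  (Num.sqrt (2 * pi * theta0))^-1 *
  expR (- ((v - u0) ^+ 2 / (2 * theta0))).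

Definition density (f : R * R -> R) (x : R) : R :=
  \int[mu]_(v in setT) f (x, v).

Definition innerM (a b u0 theta0 : R) (w z : R * R -> R) : R :=
  \int[mu2]_(p in phase a b) (w p * z p * (maxwellian u0 theta0 p.2)^-1).

Definition normM (a b u0 theta0 : R) (w : R * R -> R) : R :=
  Num.sqrt (innerM a b u0 theta0 w w).

Definition PM (u0 theta0 : R) (w : R * R -> R) : R * R -> R :=
  fun p => density w p.1 * maxwellian u0 theta0 p.2.

Definition PMperp (u0 theta0 : R) (w : R * R -> R) : R * R -> R :=
  fun p => w p - PM u0 theta0 w p.

Definition lift_x (A : (R -> R) -> (R -> R)) (f : R * R -> R) : R * R -> R :=
  fun p => A (fun x => f (x, p.2)) p.1.

(* Finiteness of the norm is stated separately because [normM] is totalized. *)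
Definition phase_space (a b u0 theta0 : R) (V : set (R -> R))
    (f : R * R -> R) : Prop :=
  [/\ {ae mu, forall v, V (fun x => f (x, v))},
      measurable_fun (phase a b) f &
      mu2.-integrable (phase a b)
        (fun p => (f p ^+ 2 * (maxwellian u0 theta0 p.2)^-1)%:E)].

(* g + dt v A g + nu dt g = f_k + nu dt M n_r: with r = g this is backward
   Euler, and with r the previous iterate it is a source iteration step. *)
Definition bgk_step (a b u0 theta0 nu dt : R) (A : (R -> R) -> (R -> R))
    (fk r g : R * R -> R) : Prop :=
  (fun p => g p + dt * p.2 * lift_x A g p + nu * dt * g p) =
  (fun p => fk p + nu * dt * (maxwellian u0 theta0 p.2 * density r p.1))
    %[ae mu2 in phase a b].

End PhaseSpace.

(* Main.v *)
Require Import Defs.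
From HB Require Import structures.
From mathcomp Require Import all_boot all_order all_algebra.
From mathcomp Require Import all_classical all_reals all_analysis.
From mathcomp Require Import measurable_realfun ring lra.
Set Implicit Arguments.
Unset Strict Implicit.
Unset Printing Implicit Defensive.
Import Order.TTheory GRing.Theory Num.Theory.
Import numFieldNormedType.Exports.
Local Open Scope classical_set_scope.
Local Open Scope ring_scope.

(** The error [e] satisfies the source iteration with [fk] removed:
    [(1 + c) e' + dt v A e' = c M n_e] with [c = nu dt].  Testing against [e']
    in the weighted inner product kills the transport term, because for almost
    every [v] the [x]-integral of [(A e') e'] vanishes by skew-symmetry.  What
    remains is [(1 + c) (e', e') = c (P e, e')].  The projection [P] is
    self-adjoint and idempotent, so the right side is [c (P e, P e')], which
    Cauchy-Schwarz bounds, and the left side splits by Pythagoras.  This is the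
    first inequality; dropping the [Pperp] term and dividing by the norm of
    [P e'] gives the second.

    Two points need care.  The function [A e'] of [(x, v)] is obtained slice by
    slice and is not known to be jointly measurable; so the transport term is
    replaced by the combination [q] of [e'] and projections to which the scheme
    equates it almost everywhere.  This [q] lies in the weighted space, and
    [transport_orthogonal] applies Fubini to [q e' / M], evaluating only the
    [x]-slices through [A].  Secondly, the density of a difference is the
    difference of the densities only at almost every [x]; self-adjointness
    ([PM_selfadjoint]) moves [P] onto [e'] before the difference is formed, and
    the bilinearity of the inner product then suffices.

    The analytic input is that everything in sight is integrable: a function of
    finite weighted norm is integrable on phase space, its density is square
    integrable ([density_sqr_le]), and hence its projection has finite norm
    ([in_L2M_PM]). *)

(** * The Maxwellian *)

Section Maxwellian.
Context {R : realType} (u0 theta0 : R) (theta0_gt0 : 0 < theta0).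
Local Notation mu := (@lebesgue_measure R).
(* Lebesgue measure lives on this copy of R, whose measurable sets are those of
   the default structure but whose display is different. *)
Local Notation T := (measurableTypeR R).
Local Notation M := (maxwellian u0 theta0).

Lemma maxwellianE : M = normal_pdf u0 (Num.sqrt theta0).
Proof.
apply/funext => v; rewrite normal_pdfE ?gt_eqF ?sqrtr_gt0//.
rewrite /maxwellian /normal_peak /normal_fun sqr_sqrtr ?ltW//.
congr ((Num.sqrt _)^-1 * expR _); first by rewrite -mulr_natl; ring.
by rewrite mulNr mulr_natl.
Qed.

Lemma maxwellian_gt0 v : 0 < M v.
Proof.
by rewrite mulr_gt0 ?expR_gt0// invr_gt0 sqrtr_gt0 !mulr_gt0// pi_gt0.
Qed.

Lemma measurable_maxwellian : measurable_fun [set: T] M.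
Proof. rewrite maxwellianE; exact: measurable_normal_pdf. Qed.

Lemma integrable_maxwellian : mu.-integrable setT (EFin \o M).
Proof. rewrite maxwellianE; exact: integrable_normal_pdf. Qed.

Lemma integral_maxwellian : \int[mu]_v M v = 1.
Proof. by rewrite maxwellianE /Rintegral integral_normal_pdf. Qed.

End Maxwellian.

(** * Fubini on phase space *)

Section PhaseFubini.
Context {R : realType} (a b : R).
Local Notation mu := (@lebesgue_measure R).
Local Notation T := (measurableTypeR R).

Lemma measurable_Omega : measurable (Omega a b : set T).
Proof. exact: measurable_itv. Qed.

Lemma measurable_phase : measurable (phase a b : set (T * T)).
Proof. apply: measurableX => //; exact: measurable_Omega. Qed.

Lemma restrict_phase (F : R * R -> R) x v :
  ((EFin \o F) \_ (phase a b)) (x, v) =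
  ((EFin \o (fun x => F (x, v))) \_ (Omega a b)) x.
Proof.
rewrite !patchE.
have [Dx|Dx] := pselect (Omega a b x); first by rewrite !mem_set.
by rewrite !memNset// => -[].
Qed.

Lemma measurable_phase_l (F : R * R -> R) v :
  measurable_fun (phase a b : set (T * T)) F ->
  measurable_fun (Omega a b : set T) (fun x => F (x, v)).
Proof.
move=> mF; apply: (measurable_comp measurable_phase) mF _ => //=.
  by move=> _ [x Dx <-].
exact: (measurable_funTS (pair2_measurable v)).
Qed.

(** The product measure is defined by integrating sections in the other
    direction, so uniqueness of product measures is used to integrate over [v]
    the measure of the [x]-sections. *)
Lemma null_phase_section_l (P : set (R * R)) :
  {ae mu2, forall p, P p} -> {ae mu, forall v, {ae mu, forall x, P (x, v)}}.
Proof.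
case=> N [mN N0 PN].
have : (\int[mu]_v `|mu (ysection N v)| = 0)%E.
  rewrite -[RHS]N0 /mu2 (@product_measure_unique _ _ _ _ _ mu mu (mu \x^ mu)%E)//.
  - by apply: eq_integral => v _; rewrite gee0_abs.
  - by move=> ? ? ? ?; exact: product_measure2E.
move/(ae_eq_integral_abs mu measurableT) => /(_ (measurable_fun_ysection _ mN)).
apply: (@filterS _ _ (ae_filter_ringOfSetsType mu)) => v /= /(_ I) Nv0.
exists (ysection N v); split => //.
  exact: measurable_ysection.
by move=> x Px; rewrite /ysection/= inE; apply: PN.
Qed.

Section F.
Context (F : R * R -> R) (iF : mu2.-integrable (phase a b) (EFin \o F)).

Let iF' : (mu \x mu)%E.-integrable setT ((EFin \o F) \_ (phase a b)).
Proof.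
have [h _] := @integrable_mkcond _ _ R (mu \x mu)%E _ (EFin \o F) measurable_phase.
exact: h iF.
Qed.

Let restrict_in x : Omega a b x ->
  (fun v => ((EFin \o F) \_ (phase a b)) (x, v)) = (fun v => (F (x, v))%:E).
Proof. by move=> Dx; apply/funext => v; rewrite patchE mem_set. Qed.

Lemma ae_integrable_phase : {ae mu, forall x, Omega a b x ->
  mu.-integrable setT (fun v => (F (x, v))%:E)}.
Proof.
have := ae_integrable1 iF'.
apply: (@filterS _ _ (ae_filter_ringOfSetsType mu)) => x + Dx.
by rewrite restrict_in.
Qed.

Let FE x : Omega a b x ->
  fubini_F mu ((EFin \o F) \_ (phase a b)) x = (\int[mu]_v (F (x, v))%:E)%E.
Proof. by move=> Dx; rewrite /fubini_F restrict_in. Qed.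

Lemma measurable_phase_integral :
  measurable_fun (Omega a b : set T) (fun x => \int[mu]_v F (x, v)).
Proof.
have mI : measurable_fun (Omega a b : set T)
      (fun x => (\int[mu]_v (F (x, v))%:E)%E).
  have := measurable_funS measurableT (@subsetT _ (Omega a b))
    (measurable_fubini_F iF').
  by apply: eq_measurable_fun => x /set_mem Dx; exact: FE.
exact: (measurableT_comp (fine_measurable measurableT) mI).
Qed.

Let F_ae : {ae mu, forall x, Omega a b x ->
  ((\int[mu]_v F (x, v))%:E = fubini_F mu ((EFin \o F) \_ (phase a b)) x)%E}.
Proof.
have := ae_integrable_phase.
apply: (@filterS _ _ (ae_filter_ringOfSetsType mu)) => x + Dx => /(_ Dx) iFx.
by rewrite FE// /Rintegral fineK// integrable_fin_num.
Qed.

Let iFF : mu.-integrable (Omega a b) (fubini_F mu ((EFin \o F) \_ (phase a b))).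
Proof.
apply: integrableS (integrable_fubini_F iF') => //; exact: measurable_Omega.
Qed.

Lemma integrable_phase_integral :
  mu.-integrable (Omega a b) (fun x => (\int[mu]_v F (x, v))%:E).
Proof.
have mI := measurable_phase_integral.
apply/integrableP; split; first exact/measurable_EFinP.
have /integrableP[mFF] := iFF; apply: le_lt_trans.
rewrite le_eqVlt; apply/orP; left; apply/eqP; apply: ae_eq_integral.
- exact: measurable_Omega.
- by apply: measurableT_comp => //; exact/measurable_EFinP.
- exact: measurableT_comp.
- apply: (@filterS _ _ (ae_filter_ringOfSetsType mu)) F_ae => x + Dx.
  by move=> /(_ Dx) ->.
Qed.

Lemma phase_fubini_xv :
  \int[mu2]_(p in phase a b) F p =
  \int[mu]_(x in Omega a b) \int[mu]_v F (x, v).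
Proof.
rewrite /Rintegral; congr fine; rewrite integral_mkcond.
rewrite -(integral12_prod_meas1 iF').
transitivity (\int[mu]_(x in Omega a b)
    fubini_F mu ((EFin \o F) \_ (phase a b)) x)%E; last first.
  apply: ae_eq_integral; first exact: measurable_Omega.
  - exact: measurable_int iFF.
  - exact: measurable_int integrable_phase_integral.
  - apply: (@filterS _ _ (ae_filter_ringOfSetsType mu)) F_ae => x + Dx.
    by move=> /(_ Dx) ->.
rewrite [RHS]integral_mkcond; apply: eq_integral => x _; rewrite patchE.
have [/set_mem Dx//|/negP Dx] := boolP (x \in Omega a b).
rewrite /fubini_F integral0_eq// => v _.
by rewrite patchE memNset// => -[/mem_set].
Qed.

(** Integrating in [x] first lets an identity that holds for fixed [v] alone,
    such as the skew-symmetry of [A], act on phase space. *)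
Lemma phase_integral0 :
  {ae mu, forall v, \int[mu]_(x in Omega a b) F (x, v) = 0} ->
  \int[mu2]_(p in phase a b) F p = 0.
Proof.
move=> F0; rewrite /Rintegral integral_mkcond -(integral21_prod_meas1 iF').
rewrite (_ : integral _ _ _ = 0%E)//.
rewrite -[RHS](integral0 mu setT); apply: ae_eq_integral => //.
  exact: measurable_fubini_G iF'.
have := ae_integrable2 iF'.
apply: (@filterS2 _ _ (ae_filter_ringOfSetsType mu)) F0 => v Fv0 iFv _.
have GE : fubini_G mu ((EFin \o F) \_ (phase a b)) v =
    (\int[mu]_(x in Omega a b) (F (x, v))%:E)%E.
  rewrite [RHS]integral_mkcond; apply: eq_integral => x _.
  exact: restrict_phase.
have : fubini_G mu ((EFin \o F) \_ (phase a b)) v \is a fin_num.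
  exact: integrable_fin_num.
move=> /fineK Gfin.
transitivity (fubini_G mu ((EFin \o F) \_ (phase a b)) v) => //.
by rewrite -Gfin GE -[fine _]/(Rintegral _ _ _) Fv0.
Qed.

End F.
End PhaseFubini.

Section Tensor.
Context {R : realType} (a b : R).
Local Notation mu := (@lebesgue_measure R).
Local Notation T := (measurableTypeR R).

Lemma measurable_phase_fst (h : R -> R) :
  measurable_fun (Omega a b : set T) h ->
  measurable_fun (phase a b : set (T * T)) (fun p : R * R => h p.1).
Proof.
move=> mh; apply: (measurable_comp (@measurable_Omega R a b) _ mh).
  by move=> _ [[x v] [Dx _] <-].
exact: (measurable_funTS measurable_fst).
Qed.

Lemma measurable_phase_snd (k : R -> R) :
  measurable_fun [set: T] k ->
  measurable_fun (phase a b : set (T * T)) (fun p : R * R => k p.2).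
Proof.
move=> mk; apply: (measurableT_comp mk).
exact: (measurable_funTS measurable_snd).
Qed.

Lemma integrable_phase_tensor (h k : R -> R) :
  mu.-integrable (Omega a b) (EFin \o h) -> mu.-integrable setT (EFin \o k) ->
  mu2.-integrable (phase a b) (fun p : R * R => (h p.1 * k p.2)%:E).
Proof.
move=> ih ik.
have mh : measurable_fun (Omega a b : set T) h.
  by apply/measurable_EFinP; exact: measurable_int ih.
have mk : measurable_fun [set: T] k.
  by apply/measurable_EFinP; exact: measurable_int ik.
have mhk : measurable_fun (phase a b : set (T * T))
    (fun p : R * R => (h p.1 * k p.2)%:E).
  apply/measurable_EFinP; apply: measurable_funM.
    exact: measurable_phase_fst.
  exact: measurable_phase_snd.
have [_] := @integrable_mkcond _ _ R (mu \x mu)%E _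
  (fun p : R * R => (h p.1 * k p.2)%:E) (@measurable_phase R a b).
apply; apply/integrable12ltyP.
  exact/(measurable_restrictT _ (@measurable_phase R a b)).
have [_ hoo] := integrableP _ _ _ ih; have [_ koo] := integrableP _ _ _ ik.
set K := (\int[mu]_v `|(EFin \o k) v|)%E in koo.
have K0 : (0 <= K)%E by exact: integral_ge0.
have Kfin : K \is a fin_num by rewrite ge0_fin_numE.
rewrite (_ : integral _ _ _ = \int[mu]_(x in Omega a b) (`|(EFin \o h) x| * K))%E.
  rewrite ge0_integralZr//; [|exact: measurable_Omega|].
    by rewrite muleC lte_mul_pinfty.
  by apply: measurableT_comp => //; exact/measurable_EFinP.
rewrite [RHS]integral_mkcond; apply: eq_integral => x _.
rewrite !patchE; have [/set_mem Dx|/negP Dx] := boolP (x \in Omega a b).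
  rewrite -ge0_integralZl//.
  - by apply: eq_integral => v _; rewrite patchE mem_set//= normrM EFinM.
  - by apply: measurableT_comp => //; exact/measurable_EFinP.
rewrite integral0_eq// => v _.
by rewrite patchE memNset ?abse0// => -[/mem_set].
Qed.

End Tensor.

(** * Integrals and almost everywhere relations *)

Lemma ae_eq_Rintegral d (T : measurableType d) (R : realType)
    (m : {measure set T -> \bar R}) (D : set T) (f g : T -> R) :
  measurable D -> measurable_fun D f -> measurable_fun D g ->
  {ae m, forall x, D x -> f x = g x} ->
  \int[m]_(x in D) f x = \int[m]_(x in D) g x.
Proof.
move=> mD mf mg fg; congr fine; apply: ae_eq_integral => //.
- exact/measurable_EFinP.
- exact/measurable_EFinP.
- by apply: (@filterS _ _ (ae_filter_ringOfSetsType m)) fg => x + Dx => ->.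
Qed.

Lemma ae_le_integrable d (T : measurableType d) (R : realType)
    (m : {measure set T -> \bar R}) (D : set T) (f g : T -> R) :
  measurable D -> measurable_fun D f -> m.-integrable D (EFin \o g) ->
  {ae m, forall x, D x -> `|f x| <= g x} ->
  m.-integrable D (EFin \o f).
Proof.
move=> mD mf /integrableP[mg goo] fg; apply/integrableP; split.
  exact/measurable_EFinP.
apply: le_lt_trans goo; apply: ae_ge0_le_integral => //.
- by apply: measurableT_comp => //; exact/measurable_EFinP.
- exact: measurableT_comp.
- apply: (@filterS _ _ (ae_filter_ringOfSetsType m)) fg => x + Dx => /(_ Dx) fgx.
  by rewrite lee_fin (le_trans fgx)// ler_norm.
Qed.

(** * The weighted space and its inner product *)

Lemma le_norm_mul_sqr (R : realFieldType) (x y : R) :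
  `|x * y| <= x ^+ 2 + y ^+ 2.
Proof.
rewrite normrM -(real_normK (num_real x)) -(real_normK (num_real y)).
by move: `|x| `|y| => s t; nra.
Qed.

Section WeightedL2.
Context {R : realType} (a b u0 theta0 : R) (theta0_gt0 : 0 < theta0).
Local Notation mu := (@lebesgue_measure R).
Local Notation T := (measurableTypeR R).
Local Notation M := (maxwellian u0 theta0).

Definition in_L2M (f : R * R -> R) : Prop :=
  measurable_fun (phase a b : set (T * T)) f /\
  mu2.-integrable (phase a b) (fun p => (f p ^+ 2 * (M p.2)^-1)%:E).

Let MV_ge0 v : 0 <= (M v)^-1.
Proof. by rewrite invr_ge0 ltW// maxwellian_gt0. Qed.

Lemma measurable_maxwellianV : measurable_fun [set: T] (fun v => (M v)^-1).
Proof.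
rewrite (_ : (fun v => _) = fun v => Num.sqrt (2 * pi * theta0) *
    expR ((v - u0) ^+ 2 * (2 * theta0)^-1)); last first.
  by apply/funext => v; rewrite /maxwellian invfM invrK -expRN opprK.
apply: measurable_funM => //; apply: measurableT_comp => //.
apply: measurable_funM => //; apply: measurable_funX; exact: measurable_funB.
Qed.

Lemma in_L2M_mul f g : in_L2M f -> in_L2M g ->
  mu2.-integrable (phase a b) (fun p => (f p * g p * (M p.2)^-1)%:E).
Proof.
move=> [mf if2] [mg ig2]; have mP := @measurable_phase R a b.
apply: (le_integrable mP _ _ (integrableD mP if2 ig2)).
- apply/measurable_EFinP; apply: measurable_funM; first exact: measurable_funM.
  exact: (measurable_phase_snd measurable_maxwellianV).
- move=> p _; rewrite -EFinD -mulrDl !abse_EFin lee_fin.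
  rewrite [leLHS]normrM [leRHS]normrM.
  rewrite ler_wpM2r// (le_trans (le_norm_mul_sqr _ _))//.
  by rewrite ler_norm.
Qed.

Lemma in_L2M_lin c f g : in_L2M f -> in_L2M g ->
  in_L2M (fun p => c * f p + g p).
Proof.
move=> Wf Wg; have [mf if2] := Wf; have [mg ig2] := Wg; split.
  by apply: measurable_funD => //; exact: measurable_funM.
have mP := @measurable_phase R a b.
have := integrableD mP (integrableD mP (integrableZl mP (c ^+ 2) if2) ig2)
  (integrableZl mP (2 * c) (in_L2M_mul Wf Wg)).
apply: eq_integrable => // p _; rewrite /= -!EFinM -!EFinD; congr (_%:E).
ring.
Qed.

(** Since [Omega] is bounded, [M] has finite mass on phase space, and [|f|] is
    dominated by [f^2 / M + M]. *)
Lemma in_L2M_integrable f : in_L2M f ->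
  mu2.-integrable (phase a b) (EFin \o f).
Proof.
move=> [mf if2]; have mP := @measurable_phase R a b.
have Dfin : (mu `[a, b]%classic < +oo)%E.
  by rewrite lebesgue_measure_itv/=; case: ifP => _; rewrite ?ltry.
have i1 : mu.-integrable (Omega a b) (EFin \o cst 1).
  apply: measurable_bounded_integrable => //; first exact: measurable_Omega.
  by exists 1; split => // y /ltW y1 x _ /=; rewrite normr1.
have iM := integrable_phase_tensor i1 (integrable_maxwellian u0 theta0_gt0).
apply: (le_integrable mP _ _ (integrableD mP if2 iM)).
- exact/measurable_EFinP.
- move=> p _; rewrite -EFinD !abse_EFin lee_fin mul1r.
  have M0 := maxwellian_gt0 u0 theta0_gt0 p.2.
  rewrite [leRHS]ger0_norm; last first.
    by rewrite addr_ge0 ?(ltW M0)// mulr_ge0// sqr_ge0.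
  rewrite -(ler_pM2r M0) mulrDl divfK ?gt_eqF// -expr2.
  rewrite -[X in _ * X]gtr0_norm// -normrM.
  exact: le_norm_mul_sqr.
Qed.

Lemma innerMC f g : innerM a b u0 theta0 f g = innerM a b u0 theta0 g f.
Proof. by apply: eq_Rintegral => p _; rewrite [f p * _]mulrC. Qed.

Lemma innerM_ge0 f : 0 <= innerM a b u0 theta0 f f.
Proof. by apply: Rintegral_ge0 => p _; rewrite mulr_ge0// -expr2 sqr_ge0. Qed.

Lemma normM_sqr f :
  normM a b u0 theta0 f ^+ 2 = innerM a b u0 theta0 f f.
Proof. by rewrite sqr_sqrtr// innerM_ge0. Qed.

Lemma innerM_linl c f g k : in_L2M f -> in_L2M g -> in_L2M k ->
  innerM a b u0 theta0 (fun p => c * f p + g p) k =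
  c * innerM a b u0 theta0 f k + innerM a b u0 theta0 g k.
Proof.
move=> Wf Wg Wk; have mP := @measurable_phase R a b.
rewrite /innerM -RintegralZl//; last exact: in_L2M_mul.
rewrite -RintegralD//; last exact: in_L2M_mul.
  by apply: eq_Rintegral => p _; ring.
rewrite (_ : EFin \o _ = (fun p => c%:E * (f p * k p * (M p.2)^-1)%:E)%E).
  by apply: integrableZl => //; exact: in_L2M_mul.
by apply/funext => p /=.
Qed.

(** The form is only semi-definite, so a vanishing norm of [f] is treated apart
    from the discriminant argument. *)
Lemma innerM_cauchy_schwarz f g : in_L2M f -> in_L2M g ->
  innerM a b u0 theta0 f g <= normM a b u0 theta0 f * normM a b u0 theta0 g.
Proof.
move=> Wf Wg; set F := normM _ _ _ _ f; set G := normM _ _ _ _ g.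
set C := innerM _ _ _ _ f g.
have F0 : 0 <= F by exact: sqrtr_ge0.
have G0 : 0 <= G by exact: sqrtr_ge0.
have pos t : 0 <= t ^+ 2 * F ^+ 2 + 2 * t * C + G ^+ 2.
  have := innerM_ge0 (fun p => t * f p + g p).
  rewrite innerM_linl//; last exact: in_L2M_lin.
  rewrite (innerMC f) (innerMC g) !innerM_linl// (innerMC g f).
  rewrite -!normM_sqr -/F -/G -/C => /le_trans; apply; rewrite le_eqVlt.
  by apply/orP; left; apply/eqP; ring.
have [F_eq0|F_neq0] := eqVneq F 0.
  (* The quadratic degenerates to an affine function of t, which takes the
     value -1 at this point unless C vanishes. *)
  have := pos (- (G ^+ 2 + 1) / (2 * C)); rewrite F_eq0 mul0r.
  have [->//|C_neq0] := eqVneq C 0.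
  by rewrite (_ : _ + _ = - 1) ?ler0N1//; field.
(* The quadratic in t attains its minimum at this point. *)
have := pos (- C / F ^+ 2).
rewrite (_ : _ + _ = (F ^+ 2 * G ^+ 2 - C ^+ 2) / F ^+ 2); last by field.
rewrite pmulr_lge0 ?invr_gt0 ?exprn_gt0 ?lt_def ?F_neq0// subr_ge0 -exprMn.
have [C0 _|C0] := leP C 0; first by rewrite (le_trans C0)// mulr_ge0.
by rewrite ler_pXn2r// ?nnegrE ?mulr_ge0// ltW.
Qed.

End WeightedL2.

(** * The projection onto the Maxwellian *)

Section MaxwellianProjection.
Context {R : realType} (a b u0 theta0 : R) (theta0_gt0 : 0 < theta0).
Local Notation mu := (@lebesgue_measure R).
Local Notation T := (measurableTypeR R).
Local Notation M := (maxwellian u0 theta0).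
Local Notation L2M := (in_L2M a b u0 theta0).
Local Notation "<| f , g |>" := (innerM a b u0 theta0 f g).
Local Notation P := (PM u0 theta0).

Lemma measurable_density f : L2M f ->
  measurable_fun (Omega a b : set T) (density f).
Proof.
by move=> Wf; exact: measurable_phase_integral (in_L2M_integrable theta0_gt0 Wf).
Qed.

(** Cauchy-Schwarz in [v] with the weight of unit mass [M].  Writing [t] for the
    density at [x], it follows by integrating in [v] the pointwise inequality
    [f^2 / M >= 2 t f - t^2 M], the right side of which has integral [t^2]. *)
Lemma density_sqr_le f : L2M f ->
  {ae mu, forall x, Omega a b x ->
     density f x ^+ 2 <= \int[mu]_v (f (x, v) ^+ 2 * (M v)^-1)}.
Proof.
move=> Wf; have [_ if2] := Wf.
have if1 := ae_integrable_phase (in_L2M_integrable theta0_gt0 Wf).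
apply: (@filterS2 _ _ (ae_filter_ringOfSetsType mu)) if1 (ae_integrable_phase if2).
move=> x + + Dx => /(_ Dx) if1 /(_ Dx) if2x; set t := density f x.
have iM := integrable_maxwellian u0 theta0_gt0.
have i1 : mu.-integrable setT (EFin \o (fun v => 2 * t * f (x, v))).
  exact: (integrableZl measurableT (2 * t) if1).
have i2 : mu.-integrable setT (EFin \o (fun v => t ^+ 2 * M v)).
  exact: (integrableZl measurableT (t ^+ 2) iM).
apply: (@le_trans _ _ (\int[mu]_v (2 * t * f (x, v) - t ^+ 2 * M v))).
  rewrite RintegralB// RintegralZl// RintegralZl// integral_maxwellian//.
  rewrite -/(density f x) -/t.
  by rewrite mulr1 -mulrA -expr2; lra.
apply: le_Rintegral => //; first exact: (integrableB measurableT i1 i2).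
move=> v _; have M0 := maxwellian_gt0 u0 theta0_gt0 v.
rewrite ler_pdivlMr// -subr_ge0.
rewrite (_ : _ - _ = (f (x, v) - t * M v) ^+ 2) ?sqr_ge0//; ring.
Qed.

Lemma integrable_density_sqr f : L2M f ->
  mu.-integrable (Omega a b) (EFin \o (fun x => density f x ^+ 2)).
Proof.
move=> Wf; have [_ if2] := Wf.
apply: (ae_le_integrable _ _ (integrable_phase_integral if2)).
- exact: measurable_Omega.
- by apply: measurable_funX; exact: measurable_density.
- apply: (@filterS _ _ (ae_filter_ringOfSetsType mu)) (density_sqr_le Wf).
  by move=> x + Dx => /(_ Dx); rewrite ger0_norm ?sqr_ge0.
Qed.

(** The square of the projection divided by [M] is the tensor product of the
    squared density, integrable on [Omega], with [M]. *)
Lemma in_L2M_PM f : L2M f -> L2M (P f).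
Proof.
move=> Wf; split.
  apply: measurable_funM.
    exact: measurable_phase_fst (measurable_density Wf).
  exact: measurable_phase_snd (measurable_maxwellian u0 theta0_gt0).
have := integrable_phase_tensor (integrable_density_sqr Wf)
  (integrable_maxwellian u0 theta0_gt0).
apply: eq_integrable; first exact: measurable_phase.
move=> p _ /=; congr (_%:E); rewrite /PM.
by field; rewrite gt_eqF// maxwellian_gt0.
Qed.

Lemma density_PM f : density (P f) =1 density f.
Proof.
move=> x; rewrite {1}/density /PM/= RintegralZl//; last exact: integrable_maxwellian.
by rewrite integral_maxwellian// mulr1.
Qed.

(** The factor [M] of the projection cancels the weight; integrating first in
    [v] leaves the density of [f].  The symmetry of the right side is the
    self-adjointness of the projection. *)
Lemma innerM_PMr f g : L2M f -> L2M g ->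
  <| f, P g |> = \int[mu]_(x in Omega a b) (density f x * density g x).
Proof.
move=> Wf Wg; have Wfg := in_L2M_mul Wf (in_L2M_PM Wg).
rewrite /innerM (phase_fubini_xv Wfg).
apply: ae_eq_Rintegral.
- exact: measurable_Omega.
- exact: measurable_phase_integral Wfg.
- by apply: measurable_funM; exact: measurable_density.
have := ae_integrable_phase (in_L2M_integrable theta0_gt0 Wf).
apply: (@filterS _ _ (ae_filter_ringOfSetsType mu)) => x + Dx => /(_ Dx) if1.
rewrite -RintegralZr//; apply: eq_Rintegral => v _ /=.
by rewrite /PM/= -mulrA mulfK// gt_eqF// maxwellian_gt0.
Qed.

Lemma innerM_PM f g : L2M f -> L2M g -> <| P f, P g |> = <| f, P g |>.
Proof.
move=> Wf Wg; rewrite (innerM_PMr (in_L2M_PM Wf) Wg) (innerM_PMr Wf Wg).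
by apply: eq_Rintegral => x _; rewrite density_PM.
Qed.

Lemma PM_selfadjoint f g : L2M f -> L2M g -> <| P f, g |> = <| f, P g |>.
Proof.
move=> Wf Wg; rewrite innerMC (innerM_PMr Wg Wf) (innerM_PMr Wf Wg).
by apply: eq_Rintegral => x _; rewrite mulrC.
Qed.

Lemma innerM_pythagoras f : L2M f ->
  <| f, f |> = <| P f, P f |> + <| PMperp u0 theta0 f, PMperp u0 theta0 f |>.
Proof.
move=> Wf; have WP := in_L2M_PM Wf.
have -> : PMperp u0 theta0 f = fun p => -1 * P f p + f p.
  by apply/funext => p; rewrite /PMperp; ring.
have Wl : L2M (fun p => -1 * P f p + f p) by exact: in_L2M_lin.
rewrite innerM_linl// (innerMC _ _ _ _ f) (innerMC _ _ _ _ (P f)) !innerM_linl//.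
by rewrite (innerMC _ _ _ _ (P f) f) innerM_PM//; ring.
Qed.

End MaxwellianProjection.

(** * The transport term *)

Section Transport.
Context {R : realType} (a b h : R) (s : seq R) (V : set (R -> R))
  (A : (R -> R) -> (R -> R)).
Context (hV : dg_space a b s V) (hA : central_difference a b h V A).
Local Notation mu := (@lebesgue_measure R).
Local Notation T := (measurableTypeR R).

Lemma dg_measurable u : V u -> measurable_fun (Omega a b : set T) u.
Proof. by move=> /(dg_L2 hV)[]. Qed.

Lemma dg_integrable_mul u w : V u -> V w ->
  mu.-integrable (Omega a b) (EFin \o (fun x => u x * w x)).
Proof.
move=> Vu Vw; have [_ iu] := dg_L2 hV Vu; have [_ iw] := dg_L2 hV Vw.
have mD := @measurable_Omega R a b.
apply: (le_integrable mD _ _ (integrableD mD iu iw)).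
  apply/measurable_EFinP.
  by apply: measurable_funM; exact: dg_measurable.
move=> x _ /=; rewrite lee_fin (le_trans (le_norm_mul_sqr _ _))//.
exact: ler_norm.
Qed.

Lemma skew_energy0 u : V u -> \int[mu]_(x in Omega a b) (A u x * u x) = 0.
Proof.
move=> Vu; have := cd_skew hA Vu Vu.
under [X in _ = - X]eq_Rintegral do rewrite mulrC.
by move/eqP; rewrite -addr_eq0 -mulr2n mulrn_eq0 => /eqP.
Qed.

(** The discrete counterpart of the conservation of the weighted norm by free
    transport.  The measurable function [q] stands for the transport term, whose
    own measurability in [(x, v)] is not available.  On an [x]-slice the factor
    [v / M v] is a constant, which leaves a multiple of the integral of
    [(A e) e]. *)
Lemma transport_orthogonal u0 theta0 dt (f g q : R * R -> R) :
    {ae mu, forall v, V (fun x => f (x, v))} ->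
    {ae mu, forall v, V (fun x => g (x, v))} ->
    in_L2M a b u0 theta0 q ->
    in_L2M a b u0 theta0 (fun p => f p - g p) ->
    {ae mu2, forall p, phase a b p ->
       q p = dt * p.2 * (lift_x A f p - lift_x A g p)} ->
  innerM a b u0 theta0 q (fun p => f p - g p) = 0.
Proof.
move=> Vf Vg Wq We qE; have mqe := in_L2M_mul Wq We.
apply: (phase_integral0 mqe); rewrite /=.
apply: (@filterS3 _ _ (ae_filter_ringOfSetsType mu)) Vf Vg (null_phase_section_l qE).
move=> v Vf Vg qvE; set e : R -> R := fun x => f (x, v) - g (x, v).
have eE : e = fun x => -1 * g (x, v) + f (x, v).
  by apply/funext => x; rewrite /e; ring.
have Ve : V e by rewrite eE; apply: (dg_add hV) => //; exact: (dg_scale hV).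
have Vu := cd_stable hA Ve.
transitivity (\int[mu]_(x in Omega a b)
    (dt * v * (maxwellian u0 theta0 v)^-1 * (A e x * e x))).
  apply: ae_eq_Rintegral.
  - exact: measurable_Omega.
  - apply: (measurable_phase_l (F := fun p =>
      q p * (f p - g p) * (maxwellian u0 theta0 p.2)^-1)).
    by apply/measurable_EFinP; exact: measurable_int mqe.
  - apply: measurable_funM => //.
    by apply: measurable_funM; exact: dg_measurable.
  have := cd_linear hA (-1) Vg Vf.
  apply: (@filterS2 _ _ (ae_filter_ringOfSetsType mu)) qvE => x qx Ax Dx.
  rewrite qx//= /lift_x/= -/(e x) eE Ax//; ring.
rewrite RintegralZl ?skew_energy0 ?mulr0//; first exact: measurable_Omega.
exact: dg_integrable_mul.
Qed.

End Transport.

Lemma phase_space_in_L2M (R : realType) (a b u0 theta0 : R)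
    (V : set (R -> R)) f :
  phase_space a b u0 theta0 V f -> in_L2M a b u0 theta0 f.
Proof. by case. Qed.

(** * The contraction estimate *)

Lemma contraction_of_energy_bound (R : realFieldType) (c x y z : R) :
  0 < c -> 0 <= x -> 0 <= z ->
  (1 + c) * x ^+ 2 + (1 + c) * y ^+ 2 <= c * z * x -> x <= c / (1 + c) * z.
Proof.
move=> c0 x0 z0 bound; have c1 : 0 < 1 + c by rewrite addr_gt0.
rewrite mulrAC ler_pdivlMr// [_ * (1 + c)]mulrC.
have [->|xn0] := eqVneq x 0; first by rewrite mulr0 mulr_ge0// ltW.
have xgt0 : 0 < x by rewrite lt_def xn0.
rewrite -(ler_pM2r xgt0); apply: le_trans bound.
by rewrite -mulrA -expr2 lerDl mulr_ge0 ?sqr_ge0// ltW.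
Qed.

Theorem proposition4p1 (R : realType)
    (a b : R) (hab : a < b)
    (s : seq R) (hs : itv_partition a b s)
    (h : R) (hh : 0 < h)
    (V : set (R -> R)) (hV : dg_space a b s V)
    (A : (R -> R) -> (R -> R)) (hA : central_difference a b h V A)
    (u0 theta0 : R) (htheta0 : 0 < theta0)
    (nu dt : R) (hnu : 0 < nu) (hdt : 0 < dt)
    (fk fk1 : R * R -> R) (f : nat -> R * R -> R)
    (hfk : phase_space a b u0 theta0 V fk)
    (hfk1 : phase_space a b u0 theta0 V fk1)
    (hf : forall l : nat, phase_space a b u0 theta0 V (f l))
    (hBE : bgk_step a b u0 theta0 nu dt A fk fk1 fk1)
    (hSI : forall l : nat, bgk_step a b u0 theta0 nu dt A fk (f l) (f l.+1)) :
  let e := fun (l : nat) (p : R * R) => f l p - fk1 p in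
  let norm := normM a b u0 theta0 in
  let P := PM u0 theta0 in
  let Pperp := PMperp u0 theta0 in
  forall l : nat,
    (1 + nu * dt) * norm (P (e l.+1)) ^+ 2
      + (1 + nu * dt) * norm (Pperp (e l.+1)) ^+ 2
      <= nu * dt * norm (P (e l)) * norm (P (e l.+1))
    /\ norm (P (e l.+1)) <= nu * dt / (1 + nu * dt) * norm (P (e l)).
Proof.
move=> e norm P Pperp l; set c := nu * dt.
have c0 : 0 < c by rewrite mulr_gt0.
have W n : in_L2M a b u0 theta0 (f n) by exact: phase_space_in_L2M (hf n).
have Wk := phase_space_in_L2M hfk1.
have subE (g : R * R -> R) : (fun p => g p - fk1 p) = (fun p => -1 * fk1 p + g p).
  by apply/funext => p; ring.
have We n : in_L2M a b u0 theta0 (e n).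
  by rewrite /e subE; exact: in_L2M_lin.
have WP g : in_L2M a b u0 theta0 g -> in_L2M a b u0 theta0 (P g).
  exact: in_L2M_PM.
(* Subtracting the two schemes, solving for the transport term and dividing by
   c gives q; P is applied to each iterate separately, since P (e l) agrees with
   P (f l) - P fk1 almost everywhere only. *)
pose q : R * R -> R := fun p =>
  - ((1 + c) / c) * e l.+1 p + (-1 * P fk1 p + P (f l) p).
have Wq : in_L2M a b u0 theta0 q.
  apply: in_L2M_lin => //; apply: in_L2M_lin; exact: WP.
have qE : {ae mu2, forall p, phase a b p -> q p =
    dt / c * p.2 * (lift_x A (f l.+1) p - lift_x A fk1 p)}.
  apply: (@filterS2 _ _ (ae_filter_ringOfSetsType mu2)) hBE (hSI l).
  move=> p BE SI Dp; move: (BE Dp) (SI Dp) => /=; rewrite -/c => {}BE {}SI.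
  rewrite /q /e /P /PM.
  have c_neq0 : c != 0 by rewrite gt_eqF.
  apply: (mulfI c_neq0).
  rewrite [LHS](_ : _ = - (1 + c) * (f l.+1 p - fk1 p) +
    c * (maxwellian u0 theta0 p.2 * density (f l) p.1) -
    c * (maxwellian u0 theta0 p.2 * density fk1 p.1)); last by field.
  rewrite [RHS](_ : _ = dt * p.2 * lift_x A (f l.+1) p -
    dt * p.2 * lift_x A fk1 p).
    by lra.
  by field.
have := transport_orthogonal hV hA _ _ Wq (We l.+1) qE.
case: (hf l.+1) => Vf _ _; case: hfk1 => Vk _ _ => /(_ Vf Vk).
rewrite /q -/(e l.+1) !innerM_linl//; try exact: WP;
  last by apply: in_L2M_lin; exact: WP.
(* Moving P onto e l.+1 allows the difference f l - fk1 to be recombined. *)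
rewrite !PM_selfadjoint// -innerM_linl//; last exact: WP.
rewrite -subE -/(e l) -innerM_PM// => energy.
have {energy} energy : (1 + c) * innerM a b u0 theta0 (e l.+1) (e l.+1) =
    c * innerM a b u0 theta0 (P (e l)) (P (e l.+1)).
  rewrite -[RHS]subr0 -(mulr0 c) -energy; by field; rewrite gt_eqF.
have cs : innerM a b u0 theta0 (P (e l)) (P (e l.+1)) <=
    norm (P (e l)) * norm (P (e l.+1)).
  by apply: innerM_cauchy_schwarz => //; exact: WP.
have bound : (1 + c) * norm (P (e l.+1)) ^+ 2
    + (1 + c) * norm (Pperp (e l.+1)) ^+ 2
    <= c * norm (P (e l)) * norm (P (e l.+1)).
  rewrite -mulrDr !normM_sqr// -innerM_pythagoras// energy -mulrA.
  by rewrite ler_wpM2l// ltW.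
split; first exact: bound.
by apply: contraction_of_energy_bound bound => //; exact: sqrtr_ge0.
Qed.
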